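(* Let $\mathcal{A}\subseteq\mathcal{X}$ be the unknown unsafe set, and suppose the trajectories are continuous-time trajectories $\xi(\cdot):[0,T]\to\mathcal{X}$ of a system $\dot x=f(x,u,t)$ with $u(t)\in\mathcal{U}$. Then the set $\mathcal{A}_l$ of learnable guaranteed unsafe states shrinks to the boundary of the unsafe set: $$\mathcal{A}_l\subseteq\{x\in\mathcal{A}\ |\ \mathrm{sd}(x,\mathcal{A})=0\}.$$
   Context: Setting. The state space is $\mathcal{X}\subseteq\mathbb{R}^m$ and the control set is $\mathcal{U}$. A continuous-time trajectory is a pair of functions (a continuous state trajectory $[0,T]\to\mathcal{X}$ and a control trajectory $[0,T]\to\mathcal{U}$), where the finite horizon $T$ may vary. There is an unknown unsafe set $\mathcal{A}\subseteq\mathcal{X}$. A trajectory violates the unknown constraint iff $x(t)\in\mathcal{A}$ for some $t\in[0,T]$; otherwise it is safe. A task $\Pi$ consists of a cost function $c_\Pi$ on state-control trajectories, a start state $x_s$ and a goal state $x_g$. The known constraints are the dynamics $\dot x=f(x,u,t)$, the control constraints $u(t)\in\mathcal{U}$, and $x(0)=x_s$, $x(T)=x_g$. A (safe, optimal) demonstration $\xi^*$ of $\Pi$ is a minimizer of $c_\Pi$ among all trajectories that satisfy the known constraints and are safe. The unsafe trajectories induced by $\xi^*$ are the trajectories $\xi$ that satisfy the known constraints with $c_\Pi(\xi)<c_\Pi(\xi^* )$ (these necessarily visit $\mathcal{A}$). Learnable guaranteed unsafe states. A candidate set $\mathcal{A}'\subseteq\mathcal{X}$ is consistent with a collection of demonstrations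 and of unsafe trajectories induced by those demonstrations if $\mathcal{A}'$ contains no state of any demonstration in the collection and contains at least one state of each unsafe trajectory in the collection (the states of a continuous-time trajectory are all $x(t)$, $t\in[0,T]$). A state $x$ can be learned guaranteed unsafe if, for some such collection (possibly coming from several tasks sharing the same $\mathcal{A}$, dynamics and control constraints), $x$ belongs to every consistent candidate set. $\mathcal{A}_l$ is the set of all states that can be learned guaranteed unsafe. Signed distance. For $p\in\mathbb{R}^m$ and $\mathcal{S}\subseteq\mathbb{R}^m$, $\mathrm{sd}(p,\mathcal{S})=-\inf_{y\in\partial\mathcal{S}}\Vert p-y\Vert$ if $p\in\mathcal{S}$, and $\mathrm{sd}(p,\mathcal{S})=\inf_{y\in\partial\mathcal{S}}\Vert p-y\Vert$ if $p\in\mathcal{S}^c$. *)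

(* Defs.v *)
From mathcomp Require Export all_boot all_order all_algebra.
From mathcomp Require Export all_classical all_reals all_analysis.
Export Order.TTheory GRing.Theory Num.Theory.
Export numFieldNormedType.Exports.

Set Implicit Arguments.
Unset Strict Implicit.
Unset Printing Implicit Defensive.

Local Open Scope classical_set_scope.
Local Open Scope ring_scope.

(* The library norm on 'rV[R]_m is the sup norm. *)
Definition enorm (R : realType) (m : nat) (v : 'rV[R]_m) : R :=
  Num.sqrt (\sum_(i < m) v ord0 i ^+ 2).

Definition boundary (T : topologicalType) (S : set T) : set T :=
  closure S `\` interior S.

(* Extended-real valued: when the boundary is empty the infimum is +oo. *)
Definition sd (R : realType) (m : nat) (p : 'rV[R]_m) (S : set 'rV[R]_m) :
    \bar R :=
  let dist := ereal_inf [set (enorm (p - y))%:E | y in boundary S] in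
  if `[< S p >] then (- dist)%E else dist.

Definition abs_continuous (R : realType) (m : nat) (T : R)
    (x : R -> 'rV[R]_m) : Prop :=
  forall e : R, 0 < e -> exists2 d : R, 0 < d &
    forall (n : nat) (a b : 'I_n -> R),
      (forall i, 0 <= a i /\ a i <= b i /\ b i <= T) ->
      trivIset [set: 'I_n] (fun i => `]a i, b i[%classic) ->
      \sum_(i < n) (b i - a i) < d ->
      \sum_(i < n) enorm (x (b i) - x (a i)) < e.

(* [state] and [control] are total functions of time; only their restrictions
   to [0, horizon] are meaningful. *)
Record trajectory (R : realType) (m : nat) (V : Type) := Trajectory {
  horizon : R ;
  state : R -> 'rV[R]_m ;
  control : R -> V }.

Definition time (R : realType) (m : nat) (V : Type) (xi : trajectory R m V) :
    set R :=
  [set t | 0 <= t <= horizon xi].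

Definition same_trajectory (R : realType) (m : nat) (V : Type)
    (xi xi' : trajectory R m V) : Prop :=
  [/\ horizon xi = horizon xi',
      (forall t, time xi t -> state xi t = state xi' t) &
      (forall t, time xi t -> control xi t = control xi' t)].

(* Solutions of x' = f(x, u, t) are taken in the sense of Caratheodory, so that
   discontinuous controls are allowed. *)
Definition satisfies_dynamics (R : realType) (m : nat) (V : Type)
    (f : 'rV[R]_m -> V -> R -> 'rV[R]_m) (xi : trajectory R m V) : Prop :=
  abs_continuous (horizon xi) (state xi) /\
  {ae (@lebesgue_measure R), forall t : R, 0 < t < horizon xi ->
    is_derive t 1 (state xi) (f (state xi t) (control xi t) t)}.

(* [cost_ext] makes the cost a function of the trajectories on [0, horizon]. *)
Record task (R : realType) (m : nat) (V : Type) := Task {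
  cost : trajectory R m V -> R ;
  start : 'rV[R]_m ;
  goal : 'rV[R]_m ;
  cost_ext : forall xi xi', same_trajectory xi xi' -> cost xi = cost xi' }.

Definition satisfies_known (R : realType) (m : nat) (V : Type)
    (X : set 'rV[R]_m) (U : set V) (f : 'rV[R]_m -> V -> R -> 'rV[R]_m)
    (Pi : task R m V) (xi : trajectory R m V) : Prop :=
  [/\ 0 <= horizon xi,
      (forall t, time xi t -> X (state xi t) /\ U (control xi t)),
      satisfies_dynamics f xi,
      state xi 0 = start Pi &
      state xi (horizon xi) = goal Pi].

Definition states (R : realType) (m : nat) (V : Type)
    (xi : trajectory R m V) : set 'rV[R]_m :=
  state xi @` time xi.

Definition safe (R : realType) (m : nat) (V : Type) (A : set 'rV[R]_m)
    (xi : trajectory R m V) : Prop :=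
  ~ exists2 t, time xi t & A (state xi t).

Definition demonstration (R : realType) (m : nat) (V : Type)
    (X : set 'rV[R]_m) (U : set V) (f : 'rV[R]_m -> V -> R -> 'rV[R]_m)
    (A : set 'rV[R]_m) (Pi : task R m V) (xi : trajectory R m V) : Prop :=
  [/\ satisfies_known X U f Pi xi, safe A xi &
      forall xi', satisfies_known X U f Pi xi' -> safe A xi' ->
        cost Pi xi <= cost Pi xi'].

Definition induced_unsafe (R : realType) (m : nat) (V : Type)
    (X : set 'rV[R]_m) (U : set V) (f : 'rV[R]_m -> V -> R -> 'rV[R]_m)
    (Pi : task R m V) (xidem xi : trajectory R m V) : Prop :=
  satisfies_known X U f Pi xi /\ cost Pi xi < cost Pi xidem.

Definition consistent (R : realType) (m : nat) (V : Type)
    (demos : set (task R m V * trajectory R m V))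
    (unsafes : set (trajectory R m V)) (A' : set 'rV[R]_m) : Prop :=
  (forall d, demos d -> states d.2 `&` A' = set0) /\
  (forall xi, unsafes xi -> states xi `&` A' !=set0).

(* [A_l]; the collections of demonstrations (each with its task) and of unsafe
   trajectories may be infinite. *)
Definition learnable_unsafe (R : realType) (m : nat) (V : Type)
    (X : set 'rV[R]_m) (U : set V) (f : 'rV[R]_m -> V -> R -> 'rV[R]_m)
    (A : set 'rV[R]_m) : set 'rV[R]_m :=
  [set x | exists (demos : set (task R m V * trajectory R m V))
                  (unsafes : set (trajectory R m V)),
    [/\ (forall d, demos d -> demonstration X U f A d.1 d.2),
        (forall xi, unsafes xi ->
           exists2 d, demos d & induced_unsafe X U f d.1 d.2 xi) &
        (forall A', A' `<=` X -> consistent demos unsafes A' -> A' x)]].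

(* Main.v *)
Require Import Defs.

Set Implicit Arguments.
Unset Strict Implicit.
Unset Printing Implicit Defensive.

Local Open Scope classical_set_scope.
Local Open Scope ring_scope.

(** [A] itself is consistent with the data, so every learnable state lies in
    [A].  If a learnable [x] were interior to [A], then [A `\ x] would be
    consistent as well: an unsafe trajectory starts outside [A], hence by
    continuity it meets [A] at some state other than [x] before reaching [x].
    So [x] is a boundary point of [A], where the signed distance vanishes. *)

Lemma enorm0 (R : realType) (m : nat) : enorm (0 : 'rV[R]_m) = 0.
Proof.
rewrite /enorm big1 ?sqrtr0// => i _.
by rewrite mxE expr0n.
Qed.

Lemma ler_entry_enorm (R : realType) (m : nat) (v : 'rV[R]_m) (j : 'I_m) :
  `|v ord0 j| <= enorm v.
Proof.
rewrite -sqrtr_sqr ler_wsqrtr// (bigD1 j)//= lerDl.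
by apply: sumr_ge0 => i _; exact: sqr_ge0.
Qed.

(** The point [p] itself competes in the infimum with distance 0, and the sign chosen by [sd] does
    not affect 0. *)
Lemma sd_boundary (R : realType) (m : nat) (p : 'rV[R]_m)
    (S : set 'rV[R]_m) : boundary S p -> sd p S = 0%E.
Proof.
move=> bp; rewrite /sd.
suff -> : ereal_inf [set (enorm (p - y))%:E | y in boundary S] = 0%E.
  by rewrite oppe0 if_same.
apply/eqP; rewrite eq_le; apply/andP; split.
  by apply: ereal_inf_lbound; exists p => //; rewrite subrr enorm0.
by apply: le_ereal_inf_tmp => _ [y _ <-]; rewrite lee_fin sqrtr_ge0.
Qed.

(** Absolute continuity applied to a single interval is uniform continuity on [[0, T]]. *)
Lemma abs_continuous_unif (R : realType) (m : nat) (T : R)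
    (x : R -> 'rV[R]_m) (e : R) : abs_continuous T x -> 0 < e ->
  exists2 d : R, 0 < d &
    forall a b, 0 <= a -> a <= b -> b <= T -> b - a < d ->
      enorm (x b - x a) < e.
Proof.
move=> acx /acx[d d0 xd]; exists d => // a b a0 ab bT abd.
have := xd 1%N (fun=> a) (fun=> b); rewrite !big_ord1; apply => //.
by move=> i j _ _ _; rewrite !ord1.
Qed.

(** Neighbourhoods are given by sup-norm balls; since [enorm] dominates the sup norm, the Euclidean
    ball of the same radius fits inside. *)
Lemma interior_enorm (R : realType) (m : nat) (A : set 'rV[R]_m)
    (x : 'rV[R]_m) : A° x ->
  exists2 e : R, 0 < e & forall y, enorm (x - y) < e -> A y.
Proof.
move=> /nbhs_ballP[e e0 xeA]; exists e => // y xye.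
apply: xeA; split=> // i j; rewrite ord1.
apply: le_lt_trans xye.
by have := ler_entry_enorm (x - y) j; rewrite !mxE.
Qed.

Lemma path_meets_setD1 (R : realType) (m : nat) (T : R) (A : set 'rV[R]_m)
    (x : 'rV[R]_m) (p : R -> 'rV[R]_m) :
  abs_continuous T p -> A° x -> ~ A (p 0) ->
  (exists2 t, 0 <= t <= T & A (p t)) ->
  exists2 t, 0 <= t <= T & (A `\ x) (p t).
Proof.
move=> acp /interior_enorm[e e0 xeA] nAp0 [t tT Apt].
apply: contrapT => nex.
have Ax s : 0 <= s <= T -> A (p s) -> p s = x.
  by move=> sT Aps; apply: contrapT => psx; apply: nex; exists s.
have [d d0 pd] := abs_continuous_unif acp e0.
pose Z := [set s | 0 <= s <= T /\ A (p s)].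
have Z_inf : has_inf Z.
  by split; [exists t | exists 0 => s [/andP[]]].
(* Approximating [inf Z] to within [d / 2] avoids proving that it is attained. *)
have [b [bT Apb] bd] := inf_adherent (divr_gt0 d0 (ltr0Sn R 1)) Z_inf.
have /andP[b0 bleT] := bT.
(* Stepping back by [d / 2] from [b] stays in [Z], since [p b = x] and [p]
   moves by less than [e]; hence the step passes below [inf Z] or reaches 0. *)
have [db|db] := leP (d / 2) b; last first.
  apply: nAp0; apply: xeA; rewrite -(Ax b)//; apply: pd => //.
  by rewrite subr0 (lt_trans db)// ltr_pdivrMr// ltr_pMr// ltr1n.
have ab : b - d / 2 <= b by rewrite gerBl divr_ge0// ltW.
suff /(ge_inf Z_inf.2) : Z (b - d / 2) by rewrite leNgt ltrBlDr bd.
have a0 : 0 <= b - d / 2 by rewrite subr_ge0.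
split; first by rewrite a0 (le_trans ab).
apply: xeA; rewrite -(Ax b)//; apply: pd => //.
by rewrite subKr ltr_pdivrMr// ltr_pMr// ltr1n.
Qed.

(** The demonstration is safe at time 0. Its induced unsafe trajectories share this start, so they
    too begin outside [A]. *)
Lemma demonstration_startNA (R : realType) (m : nat) (X : set 'rV[R]_m)
    (V : Type) (U : set V) (f : 'rV[R]_m -> V -> R -> 'rV[R]_m)
    (A : set 'rV[R]_m)
    (Pi : task R m V) (xi : trajectory R m V) :
  demonstration X U f A Pi xi -> ~ A (start Pi).
Proof.
move=> [[T0 _ _ <- _] sxi _] A0.
by apply: sxi; exists 0; rewrite // /time /= lexx.
Qed.

(** A safe trajectory of lower cost would contradict the optimality of the demonstration. *)
Lemma induced_unsafe_visits (R : realType) (m : nat) (X : set 'rV[R]_m)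
    (V : Type) (U : set V) (f : 'rV[R]_m -> V -> R -> 'rV[R]_m)
    (A : set 'rV[R]_m)
    (Pi : task R m V) (xidem xi : trajectory R m V) :
  demonstration X U f A Pi xidem -> induced_unsafe X U f Pi xidem xi ->
  exists2 t, time xi t & A (state xi t).
Proof.
move=> [_ _ opt] [kxi lt_cost]; apply: contrapT => sxi.
by have := opt _ kxi sxi; rewrite leNgt lt_cost.
Qed.

(** Demonstrations avoid [A], hence all its subsets, so only the visits remain to be checked. This
    serves both for [A] and for [A] without [x]. *)
Lemma subset_consistent (R : realType) (m : nat) (X : set 'rV[R]_m)
    (V : Type) (U : set V) (f : 'rV[R]_m -> V -> R -> 'rV[R]_m)
    (A : set 'rV[R]_m)
    (demos : set (task R m V * trajectory R m V))
    (unsafes : set (trajectory R m V)) (A' : set 'rV[R]_m) :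
  (forall d, demos d -> demonstration X U f A d.1 d.2) -> A' `<=` A ->
  (forall xi, unsafes xi -> exists2 t, time xi t & A' (state xi t)) ->
  consistent demos unsafes A'.
Proof.
move=> dem A'A vis; split=> [d /dem[_ sd _]|xi /vis[t tT A't]].
  by apply/eqP/negPn/negP => /set0P[_ [[t tT <-] /A'A At]]; apply: sd; exists t.
by exists (state xi t); split=> //; exists t.
Qed.

Theorem corollary1 (R : realType) (m : nat) (X : set 'rV[R]_m) (V : Type)
    (U : set V) (f : 'rV[R]_m -> V -> R -> 'rV[R]_m) (A : set 'rV[R]_m)
    (A_sub_X : A `<=` X) :
  learnable_unsafe X U f A `<=` [set x | A x /\ sd x A = 0%E].
Proof.
move=> x [demos [unsafes [dem uns learn]]].
have vis xi : unsafes xi -> exists2 t, time xi t & A (state xi t).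
  by move=> /uns[d /dem ddem]; exact: induced_unsafe_visits.
have Ax : A x by apply: learn => //; exact: subset_consistent dem _ vis.
split=> //; apply: sd_boundary; split; first exact: subset_closure.
move=> intAx.
suff /learn : consistent demos unsafes (A `\ x).
  (* Learnability would put [x] into a set from which it was removed. *)
  by case=> [y [/A_sub_X]|_ /(_ erefl)].
apply: (subset_consistent dem) => [y []//|xi uxi].
have [d /dem ddem [[_ _ [acxi _] xi0 _] _]] := uns _ uxi.
apply: path_meets_setD1 acxi intAx _ (vis _ uxi).
by rewrite xi0; exact: demonstration_startNA ddem.
Qed.
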